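(* Let $G$ be a finite group such that $(G,Z(G))$ is a Camina pair. Then $|Z(G)| < |G:Z(G)|^{3/4}$.
   Context: A pair $(G,N)$ is a Camina pair if $N$ is a normal subgroup of the finite group $G$ with $1 < N < G$ (i.e. $N$ is nontrivial and proper) and every element $g \in G \setminus N$ is conjugate in $G$ to every element of the coset $gN$. Here $Z(G)$ is the center of $G$. *)

(* Defs.v *)
From HB Require Import structures.
From mathcomp Require Import all_boot.
From mathcomp Require Import all_fingroup.

Set Implicit Arguments.
Unset Strict Implicit.
Unset Printing Implicit Defensive.

Local Open Scope group_scope.

Definition Camina_pair (gT : finGroupType) (G N : {group gT}) : Prop :=
  [/\ N <| G, N :!=: 1, N \proper G
    & forall g : gT, g \in G :\: N ->
        forall h : gT, h \in g *: N -> h \in g ^: G].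

(* Main.v *)
Require Import Defs.
From HB Require Import structures.
From mathcomp Require Import all_boot all_order all_algebra.
From mathcomp Require Import all_fingroup all_solvable.
From mathcomp Require Import reals exp.
From mathcomp Require Import finfield mxabelem zify ring.

(* Put Z = Z(G).  For u outside Z the commutator map [u, -] sends
   D_u = {y | [u, y] in Z} onto Z with fibres the cosets of C_G(u), so that
   |D_u| >= 2 |Z|^2.

   If some commutator c = [u, v] is not in Z, then D_u and D_v intersect inside
   C_G(c), which has index at least |Z|; comparing orders gives
   |Z|^3 < |G : Z|^2.

   Otherwise G has class 2, Z and G / Z are elementary abelian p-groups, and the
   commutator yields a space of alternating forms on G / Z, of the dimension of
   Z over F_p, whose nonzero members are all nondegenerate.  A
   Chevalley-Warning argument bounds this dimension by half that of G / Z, so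
   |Z|^2 <= |G : Z|. *)

Set Implicit Arguments.
Unset Strict Implicit.
Unset Printing Implicit Defensive.

Import Order.TTheory GRing.Theory Num.Theory.

(** * Vanishing sums, skew determinants and alternating forms over finite fields *)

Section FiniteFieldForms.
Local Open Scope ring_scope.

(** For positive [e], substituting [b * a] for [a] multiplies the sum by [b ^+ e], and some nonzero
    [b] makes this factor differ from 1. *)
Lemma sum_expf_eq0 (F : finFieldType) (e : nat) :
  (e < #|F|.-1)%N -> \sum_(a : F) a ^+ e = 0.
Proof.
case: e => [_|e lt_e].
  (* Since [0 ^+ 0] is 1, all terms are 1; translation by 1 shows that they sum to 0. *)
  apply: (addrI (\sum_(a : F) a)); rewrite -big_split addr0 /=.
  rewrite [RHS](reindex_inj (addIr 1)) /=.
  by apply: eq_bigr => a _; rewrite expr0.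
have [b b_neq0 be_neq1] : exists2 b : F, b != 0 & b ^+ e.+1 != 1.
  (* Otherwise every nonzero element is a root of X^(e+1) - 1, which has too small a degree. *)
  apply/exists_inP; apply: contraLR lt_e => /exists_inPn b_root.
  rewrite -leqNgt -(cardC1 (0 : F)) cardE; apply: max_unity_roots => //.
    apply/allP => b; rewrite mem_enum unity_rootE => /b_root.
    by rewrite negbK.
  exact: enum_uniq.
apply: (mulfI (x := b ^+ e.+1 - 1)); first by rewrite subr_eq0.
rewrite mulr0 mulrBl mul1r big_distrr /=.
apply/eqP; rewrite subr_eq0; apply/eqP.
rewrite [RHS](reindex_inj (mulfI b_neq0)) /=.
by apply: eq_bigr => a _; rewrite exprMn.
Qed.

(* In each monomial of the product some variable has exponent < #|F| - 1, and
   summing over that variable already gives 0. *)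
Lemma sum_prod_linear_forms (F : finFieldType) (I J : finType)
    (c : J -> I -> F) : (#|J| < #|I| * #|F|.-1)%N ->
  \sum_(x : {ffun I -> F}) \prod_j \sum_i c j i * x i = 0.
Proof.
move=> lt_J; under eq_bigr do rewrite bigA_distr_bigA.
rewrite exchange_big big1 //= => f _.
under eq_bigr do rewrite big_split /=.
rewrite -big_distrr /=.
pose e i := #|[pred j | f j == i]|.
have [i lt_e] : exists i, (e i < #|F|.-1)%N.
  apply/existsP; apply: contraLR lt_J => /existsPn ge_e.
  rewrite -leqNgt -sum_nat_const.
  have -> : #|J| = (\sum_i e i)%N.
    rewrite -sum1_card (partition_big f xpredT) //=.
    by apply: eq_bigr => i _; rewrite sum1_card.
  by apply: leq_sum => i _; rewrite leqNgt ge_e.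
rewrite (eq_bigr (fun x : {ffun I -> F} => \prod_i x i ^+ e i)); last first.
  move=> x _; rewrite (partition_big f xpredT) //=; apply: eq_bigr => k _.
  by rewrite -prodr_const; apply: eq_bigr => j /eqP ->.
rewrite -(bigA_distr_bigA (fun i (a : F) => a ^+ e i)) (bigD1 i) //=.
by rewrite sum_expf_eq0 // mul0r mulr0.
Qed.

(* By induction, via the Schur complement of an invertible 2 x 2 block. *)
Lemma det_skew_square (F : fieldType) (n : nat) (A : 'M[F]_n) :
  2%:R != 0 :> F -> A^T = - A -> exists d, \det A = d ^+ 2.
Proof.
move=> nz2.
have diag0 m (B : 'M[F]_m) i : B^T = - B -> B i i = 0.
  move/matrixP/(_ i i); rewrite !mxE => /eqP.
  by rewrite -addr_eq0 -mulr2n -mulr_natl mulf_eq0 (negPf nz2) => /eqP.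
have det2 (M : 'M[F]_2) : \det M = M 0 0 * M 1 1 - M 0 1 * M 1 0.
  rewrite (expand_det_row _ 0) big_ord_recl big_ord1 /cofactor.
  rewrite !det_mx11 !mxE /= expr0 expr1 mul1r mulN1r mulrN.
  by congr (_ * M _ _ - M _ _ * M _ _); apply: val_inj.
have [k] := ubnP n; elim: k n A => // k IHk n A le_nk skewA.
have [->|nzA] := eqVneq A 0.
  case: n {A le_nk skewA} => [|n]; first by exists 1; rewrite det_mx00 expr1n.
  by exists 0; rewrite det0 expr0n.
have /existsP[i /existsP[j nzAij]] : [exists i, exists j, A i j != 0].
  apply: contraNT nzA => /existsPn A0; apply/eqP/matrixP => i j; rewrite mxE.
  by apply/eqP; move/existsPn/(_ j): (A0 i); rewrite negbK.
have neq_ij : i != j by apply: contraNneq nzAij => ->; rewrite diag0.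
case: n => [|[|n]] in A le_nk skewA nzA i j nzAij neq_ij *.
- by case: i {nzAij neq_ij}.
- by move: neq_ij; rewrite !ord1.
have [s [s0 s1]] : exists s : 'S_n.+2, s 0 = i /\ s 1 = j.
  (* [l] is where the first transposition sends 1; moving [l] to [j] leaves [i] in place. *)
  pose l := tperm 0 i 1.
  have ne_li : l != i by rewrite -[X in _ != X](tpermL 0 i) (inj_eq perm_inj).
  exists (tperm 0 i * tperm l j)%g; rewrite !permM tpermL -/l.
  by split; [apply: tpermD; rewrite // eq_sym | exact: tpermL].
pose B : 'M[F]_(2 + n) := row_perm s (col_perm s A).
have detB : \det B = \det A.
  rewrite /B row_permE col_permE !det_mulmx det_perm det_perm odd_permV.
  by rewrite mulrCA -expr2 sqrr_sign mulr1.
have skewB : B^T = - B.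
  by apply/matrixP=> x y; move/matrixP/(_ (s x) (s y)): skewA; rewrite !mxE.
rewrite -detB.
pose P := ulsubmx B; pose Q := ursubmx B.
pose R := dlsubmx B; pose S := drsubmx B.
have defB : B = block_mx P Q R S by rewrite submxK.
move: (skewB); rewrite {1 2}defB tr_block_mx opp_block_mx.
case/eq_block_mx => skewP trR trQ skewS.
have detP : \det P = B 0 1 ^+ 2.
  have P01 : P 0 1 = B 0 1.
    by rewrite !mxE; congr (A (s _) (s _)); apply: val_inj.
  have P10 : P 1 0 = - P 0 1.
    by move/matrixP/(_ 0 1): skewP; rewrite !mxE.
  by rewrite -P01 det2 P10 diag0 // mul0r add0r mulrN opprK.
have unitP : P \in unitmx.
  by rewrite unitmxE detP unitfE expf_neq0 // !mxE s0 s1.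
pose K := S - R *m invmx P *m Q.
have -> : \det B = \det P * \det K.
  have -> : B = block_mx P 0 R K *m block_mx 1%:M (invmx P *m Q) 0 1%:M.
    rewrite mulmx_block !mulmx1 !mulmx0 ?mul0mx !addr0 mulmxA mulmxV //.
    by rewrite mul1mx mulmxA addrC subrK.
  by rewrite det_mulmx det_lblock det_ublock !det1 !mulr1.
(* [K] is again skew, because [invmx P] is skew and [Q^T = - R]. *)
have [d ->] : exists d, \det K = d ^+ 2.
  apply: IHk; first by lia.
  rewrite /K !linearB /= !trmx_mul trmx_inv skewP skewS trQ trR.
  rewrite -[invmx (- P)]/((- P : 'M_2)^-1) invrN.
  by rewrite !(mulNmx, mulmxN) !opprK mulmxA.
by exists (B 0 1 * d); rewrite detP exprMn.
Qed.

(** Comparing values of [enum_rank] selects one point of each two-element orbit. *)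
Lemma big_involution (R : Type) (idx : R) (op : Monoid.com_law idx)
    (I : finType) (f : I -> I) (E : I -> R) : involutive f ->
  \big[op/idx]_(i | f i != i) E i =
  \big[op/idx]_(i | (enum_rank i < enum_rank (f i))%N) op (E i) (E (f i)).
Proof.
move=> fK; rewrite big_split.
rewrite (bigID (fun i => enum_rank i < enum_rank (f i))%N) /=.
have neqE i : (f i != i) = ((enum_rank i != enum_rank (f i) :> nat)).
  by rewrite (inj_eq val_inj) (inj_eq enum_rank_inj) eq_sym.
congr (op _ _); first by apply: eq_bigl => i; rewrite neqE; case: ltngtP.
rewrite (reindex_inj (inv_inj fK)) /=; apply: eq_bigl => i.
by rewrite neqE fK; case: ltngtP.
Qed.

Lemma sum_involution_pchar2 (R : nzRingType) (I : finType) (f : I -> I)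
    (E : I -> R) : 2%N \in [pchar R] -> involutive f ->
  (forall i, E (f i) = E i) -> \sum_i E i = \sum_(i | f i == i) E i.
Proof.
move=> char2 fK Ef; rewrite (bigID (fun i => f i == i)) /= big_involution //.
by rewrite [X in _ + X]big1 ?addr0 // => i _; rewrite /= Ef addrr_pchar2.
Qed.

Section FormSpace.
Variables (F : finFieldType) (n m : nat) (b : 'I_n -> 'I_n -> 'I_m -> F).

Definition form_mx (x : {ffun 'I_m -> F}) : 'M[F]_n :=
  \matrix_(i, j) \sum_k b i j k * x k.

(** The power of the determinant expands into signed products of [k * n] linear forms in [m]
    variables, and each product sums to 0. *)
Lemma sum_det_form_mx (k : nat) : (k * n < m * #|F|.-1)%N ->
  \sum_x \det (form_mx x) ^+ k = 0.
Proof.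
move=> lt_kn.
have detX (A : 'M[F]_n) : \det A ^+ k =
    \sum_(f : {ffun 'I_k -> 'S_n}) \prod_t ((-1) ^+ f t * \prod_i A i (f t i)).
  rewrite -(bigA_distr_bigA (fun (_ : 'I_k) (s : 'S_n) =>
    (-1) ^+ s * \prod_i A i (s i))).
  by rewrite prodr_const card_ord.
under eq_bigr do rewrite detX.
rewrite exchange_big big1 //= => f _.
under eq_bigr do rewrite big_split /=.
rewrite -big_distrr /=.
under [X in _ * X]eq_bigr do rewrite pair_bigA /=.
have lt_card : (#|{: 'I_k * 'I_n}| < #|'I_m| * #|F|.-1)%N.
  by rewrite card_prod !card_ord.
rewrite -[RHS](mulr0 (\prod_t (-1) ^+ f t)); congr (_ * _).
rewrite -[RHS](sum_prod_linear_forms (fun u i => b u.2 (f u.1 u.2) i) lt_card).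
by apply: eq_bigr => x _; apply: eq_bigr => u _; rewrite mxE.
Qed.

Hypothesis bii : forall i k, b i i k = 0.
Hypothesis bji : forall i j k, b j i k = - b i j k.

Lemma form_mxC x i j : form_mx x j i = - form_mx x i j.
Proof.
by rewrite !mxE -sumrN; apply: eq_bigr => k _; rewrite bji mulNr.
Qed.

(* Inverse permutations contribute equally to the determinant, so only
   involutions survive, and those with a fixed point contribute 0.  The product
   over a fixed-point-free involution is a product of squares a * a = a, hence
   of n/2 linear forms. *)
Lemma sum_det_form_mx_card2 : #|F| = 2%N -> (n < 2 * m)%N ->
  \sum_x \det (form_mx x) = 0.
Proof.
move=> cardF lt_n.
have char2 : 2%N \in [pchar F] by apply: (card_finPcharP (n := 1)).
have idemF (a : F) : a * a = a by rewrite -expr2 -cardF expf_card.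
have symB x i j : form_mx x j i = form_mx x i j.
  by rewrite form_mxC oppr_pchar2.
have detE (A : 'M[F]_n) : \det A = \sum_(s : 'S_n) \prod_i A i (s i).
  by apply: eq_bigr => s _; rewrite oppr_pchar2 // expr1n mul1r.
under eq_bigr do rewrite detE.
rewrite exchange_big /= (sum_involution_pchar2 char2 (@invgK _)); last first.
  move=> s; apply: eq_bigr => x _; rewrite (reindex_inj (@perm_inj _ s)).
  by apply: eq_bigr => i _; rewrite permK symB.
apply: big1 => s /eqP sV.
have sK : involutive s by move=> i; rewrite -{1}sV permK.
have [/existsP[i /eqP si] | /existsPn s_free] := boolP [exists i, s i == i].
  apply: big1 => x _; rewrite (bigD1 i) //= si mxE big1 ?mul0r // => k _.
  by rewrite bii mul0r.
pose J := [set i | enum_rank i < enum_rank (s i)]%N.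
(* Kept generic in the operation: addition counts [J], multiplication regroups the product. *)
have big_s (R : Type) (idx : R) (op : Monoid.com_law idx) (E : 'I_n -> R) :
    \big[op/idx]_i E i = \big[op/idx]_(i in J) op (E i) (E (s i)).
  transitivity (\big[op/idx]_(i | s i != i) E i).
    by apply: eq_bigl => i; rewrite s_free.
  by rewrite big_involution //; apply: eq_bigl => i; rewrite inE.
have card_J : (#|J| * 2 = n)%N.
  by rewrite -sum_nat_const -[RHS]card_ord -sum1_card [RHS]big_s.
have lt_J : (#|'I_(#|J|)| < #|'I_m| * #|F|.-1)%N.
  by rewrite cardF !card_ord; lia.
rewrite -[RHS](sum_prod_linear_forms
  (fun u i => b (enum_val u) (s (enum_val u)) i) lt_J).
apply: eq_bigr => x _; rewrite big_s big_enum_val; apply: eq_bigr => u _.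
by rewrite /= sK (symB x (enum_val u)) idemF mxE.
Qed.

End FormSpace.

(* Sum a suitable power of the determinant over the whole space: the value is
   -1 when all nonzero forms are nondegenerate.  For p odd, det^((p-1)/2) has
   degree n(p-1)/2 and is 1 on nondegenerate forms since their determinants are
   squares; for p = 2 the determinant itself is used, which then has the degree
   n/2 of the Pfaffian as a function. *)
Lemma alternating_space_dim (p n m : nat) (b : 'I_n -> 'I_n -> 'I_m -> 'F_p) :
    prime p -> (0 < n)%N ->
    (forall i k, b i i k = 0) -> (forall i j k, b j i k = - b i j k) ->
    (forall x, x != 0 -> \det (form_mx b x) != 0) ->
  (2 * m <= n)%N.
Proof.
case: n b => // n b p_pr _ bii bji nsg; rewrite leqNgt; apply/negP => lt_n.
have m_gt0 : (0 < m)%N by lia.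
have cardF := card_Fp p_pr.
have expf1 (a : 'F_p) : a != 0 -> a ^+ p.-1 = 1.
  move=> nz_a; apply: (mulfI nz_a).
  by rewrite mulr1 -exprS prednK ?prime_gt0 // -{2}(expf_card a) cardF.
have form0 : form_mx b 0 = 0.
  by apply/matrixP=> i j; rewrite !mxE big1 // => k _; rewrite ffunE mulr0.
(* The constant 1 sums to p^m = 0 as [m] is positive, so omitting the term at 0 leaves -1. *)
have sum_neq0 (h : {ffun 'I_m -> 'F_p} -> 'F_p) :
    h 0 = 0 -> (forall x, x != 0 -> h x = 1) -> \sum_x h x != 0.
  move=> h0 h1; have: \sum_(x : {ffun 'I_m -> 'F_p}) (1 : 'F_p) = 0.
    rewrite sumr_const card_ffun cardF card_ord natrX pchar_Fp_0 // expr0n.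
    by rewrite gtn_eqF.
  move/eqP; rewrite (bigD1 (0 : {ffun 'I_m -> 'F_p})) //= addrC addr_eq0.
  move=> /eqP sum1; rewrite (bigD1 (0 : {ffun 'I_m -> 'F_p})) //= h0 add0r.
  by rewrite (eq_bigr (fun _ => 1)) // sum1 oppr_eq0 oner_eq0.
case: (even_prime p_pr) => [p2 | p_odd].
  suff /eqP[] : \sum_x \det (form_mx b x) != 0.
    by apply: sum_det_form_mx_card2 => //; rewrite cardF.
  apply: sum_neq0 => [|x /nsg nz]; first by rewrite form0 det0.
  by have := expf1 _ nz; rewrite (_ : p.-1 = 1%N) ?p2.
have p_gt2 : (2 < p)%N by apply: odd_prime_gt2.
have p_half : (p.-1 = 2 * p.-1./2)%N by lia.
suff /eqP[] : \sum_x \det (form_mx b x) ^+ p.-1./2 != 0.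
  by apply: sum_det_form_mx; rewrite cardF; nia.
apply: sum_neq0 => [|x nz_x].
  by rewrite form0 det0 expr0n; case: (p.-1./2) p_half p_gt2 => //; lia.
have nz2 : 2%:R != 0 :> 'F_p.
  by rewrite -(dvdn_pcharf (pchar_Fp p_pr)) gtnNdvd.
have skewB : (form_mx b x)^T = - form_mx b x.
  by apply/matrixP=> i j; rewrite mxE [RHS]mxE form_mxC.
have [d det_d] := det_skew_square nz2 skewB.
have nz_d : d != 0 by have := nsg x nz_x; rewrite det_d expf_eq0.
by rewrite det_d -exprM -p_half expf1.
Qed.

End FiniteFieldForms.

(** * Groups forming a Camina pair with their center *)

Section CaminaCenter.
Local Open Scope group_scope.
Variables (gT : finGroupType) (G : {group gT}).
Hypothesis caminaG : Camina_pair G 'Z(G)%G.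
Local Notation Z := 'Z(G).

Lemma comm_centerl z y : z \in Z -> y \in G -> [~ z, y] = 1.
Proof. by move=> Zz Gy; apply/eqP/commgP; case/centerP: Zz => _; apply. Qed.

Lemma comm_centerr z y : z \in Z -> y \in G -> [~ y, z] = 1.
Proof. by move=> Zz Gy; rewrite -invg_comm comm_centerl ?invg1. Qed.

Lemma conj_center z y : z \in Z -> y \in G -> z ^ y = z.
Proof. by move=> Zz Gy; rewrite conjg_mulR comm_centerl ?mulg1. Qed.

Lemma comm_mul_centerl z x y :
  z \in Z -> x \in G -> y \in G -> [~ x * z, y] = [~ x, y].
Proof.
move=> Zz Gx Gy; rewrite commMgR (comm_centerl Zz Gy).
by rewrite (comm_centerr Zz) ?groupR ?mulg1.
Qed.

Lemma comm_mul_centerr z x y :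
  z \in Z -> x \in G -> y \in G -> [~ x, y * z] = [~ x, y].
Proof.
move=> Zz Gx Gy; apply: invg_inj; rewrite !invg_comm; exact: comm_mul_centerl.
Qed.

Lemma Camina_comm_surj g z :
  g \in G -> g \notin Z -> z \in Z -> exists2 y, y \in G & [~ g, y] = z.
Proof.
move=> Gg nZg Zz; have [_ _ _ conjG] := caminaG.
have /imsetP[y Gy def_y] : g * z \in g ^: G.
  by apply: (conjG g); [rewrite inE nZg | rewrite mem_lcoset mulKg].
by exists y => //; rewrite commgEl -def_y mulKg.
Qed.

(** Presents D_u as the normalizer of a coset, which makes it a group at once. *)
Lemma mem_norm_lcoset u y :
  u \in G -> y \in G -> (y \in 'N_G(u *: Z)) = ([~ u, y] \in Z).
Proof.
move=> Gu Gy; rewrite inE Gy /=; apply/normP/idP => [uZy | Zuy].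
  rewrite commgEl -mem_lcoset -uZy memJ_conjg.
  exact: lcoset_refl.
apply/eqP; rewrite eqEcard cardJg leqnn andbT.
apply/subsetP=> _ /imsetP[_ /lcosetP[z Zz ->] ->].
rewrite mem_lcoset conjMg (conj_center Zz) // mulgA -commgEl.
by rewrite groupM.
Qed.

(** The class of [u] under D_u contains [u *: Z], and its centralizer in D_u contains [Z] properly
    because of [u]; the latter gives the factor 2. *)
Lemma Camina_card_norm_lcoset u : u \in G -> u \notin Z ->
  2 * #|Z| ^ 2 <= #|'N_G(u *: Z)|.
Proof.
move=> Gu nZu; set D := 'N_G(u *: Z).
have sDG : D \subset G by apply: subsetIl.
have le_class : #|Z| <= #|u ^: D|.
  rewrite -(card_lcoset Z u).
  apply/subset_leq_card/subsetP=> _ /lcosetP[z Zz ->].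
  have [y Gy def_z] := Camina_comm_surj Gu nZu Zz.
  have Dy : y \in D by rewrite mem_norm_lcoset ?def_z.
  by rewrite -def_z commgEl mulKVg memJ_class.
have lt_cent : 2 * #|Z| <= #|'C_D[u]|.
  have sZC : Z \subset 'C_D[u].
    apply/subsetP=> z Zz; have Gz := subsetP (center_sub G) z Zz.
    rewrite inE mem_norm_lcoset // comm_centerr // group1 /=.
    by apply/cent1P; case/centerP: Zz => _ /(_ u Gu).
  rewrite -(Lagrange sZC) mulnC leq_mul2l indexg_gt1 orbC.
  apply/orP; left; apply: contra nZu => /subsetP; apply.
  by rewrite inE cent1id mem_norm_lcoset // commgg group1.
have sCD : 'C_D[u] \subset D by apply: subsetIl.
rewrite -(Lagrange sCD) index_cent1.
by rewrite -mulnn mulnA leq_mul.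
Qed.

(* Conjugation by w multiplies u and v by central elements, hence fixes
   [u, v]. *)
Lemma cent_comm_norm_lcoset u v :
  u \in G -> v \in G -> 'N_G(u *: Z) :&: 'N_G(v *: Z) \subset 'C_G[[~ u, v]].
Proof.
move=> Gu Gv; apply/subsetP=> w /setIP[Du Dv].
have Gw : w \in G by case/setIP: Du.
rewrite mem_norm_lcoset // in Du; rewrite mem_norm_lcoset // in Dv.
rewrite inE Gw; apply/cent1P/commute_sym/commgP/conjg_fixP.
rewrite conjRg 2!conjg_mulR comm_mul_centerl ?comm_mul_centerr //.
by rewrite groupM // (subsetP (center_sub G)).
Qed.

(** The product formula bounds |D_u||D_v| by |G||C_G(c)|, and the class of c contains the coset cZ.
    Hence 4|Z|^3 <= |G : Z|^2, the factor 4 giving strictness. *)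
Lemma Camina_bound_class_gt2 : ~~ (G^`(1) \subset Z) ->
  #|Z| ^ 3 < #|G : Z| ^ 2.
Proof.
have Z_gt0 : 0 < #|Z| := cardG_gt0 _.
rewrite gen_subG => /subsetPn[_ /imset2P[u v Gu Gv ->] nZc].
have nZu : u \notin Z by apply: contra nZc => Zu; rewrite comm_centerl ?group1.
have nZv : v \notin Z by apply: contra nZc => Zv; rewrite comm_centerr ?group1.
have Gc : [~ u, v] \in G by rewrite groupR.
have leDu := Camina_card_norm_lcoset Gu nZu.
have leDv := Camina_card_norm_lcoset Gv nZv.
have leI := subset_leq_card (cent_comm_norm_lcoset Gu Gv).
have leC : #|'C_G[[~ u, v]]| * #|Z| <= #|G|.
  rewrite -(Lagrange (subsetIl G 'C[[~ u, v]])) index_cent1 leq_mul2l.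
  rewrite -(card_lcoset Z [~ u, v]); apply/orP; right.
  apply/subset_leq_card/subsetP=> _ /lcosetP[z Zz ->].
  have [y Gy <-] := Camina_comm_surj Gc nZc Zz.
  by rewrite commgEl mulKVg memJ_class.
have leP : #|'N_G(u *: Z)| * #|'N_G(v *: Z)| <= #|G| * #|'C_G[[~ u, v]]|.
  by rewrite mul_cardG leq_mul // subset_leq_card // mul_subG ?subsetIl.
have := Lagrange (center_sub G).
move=> defG; rewrite -defG in leC leP.
have := leq_mul (leq_trans (leq_mul leDu leDv) leP) (leqnn #|Z|).
rewrite -[X in _ <= X]mulnA => /leq_trans/(_ (leq_mul (leqnn _) leC)).
have -> : (2 * #|Z| ^ 2 * (2 * #|Z| ^ 2) * #|Z|
         = #|Z| ^ 2 * (4 * #|Z| ^ 3))%N by ring.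
rewrite mulnn expnMn leq_pmul2l ?expn_gt0 ?Z_gt0 //; apply: leq_trans.
by rewrite ltn_Pmull // expn_gt0 Z_gt0.
Qed.

Lemma comm_morphl x y w : G^`(1) \subset Z ->
  x \in G -> y \in G -> w \in G -> [~ x * y, w] = [~ x, w] * [~ y, w].
Proof.
move=> sG'Z Gx Gy Gw; rewrite commMgR (@comm_centerl [~ x, w]) ?mulg1 //.
by rewrite (subsetP sG'Z) ?mem_commg.
Qed.

(** Take [g] of prime order p modulo [Z]. Each z in [Z] is some [g, y], so z^p = [g^p, y] = 1; then
    [h^p, y] = [h, y]^p = 1 makes every h^p central. *)
Lemma Camina_class2_abelem : G^`(1) \subset Z ->
  exists p, [/\ prime p, p.-abelem Z & p.-abelem (G / Z)].
Proof.
move=> sG'Z; have [nsZG _ /properP[sZG [g0 Gg0 nZg0]] _] := caminaG.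
have [_ nZG] := andP nsZG.
have commX g y n : g \in G -> y \in G -> [~ g ^+ n, y] = [~ g, y] ^+ n.
  move=> Gg Gy; elim: n => [|n IHn]; first by rewrite !expg0 comm1g.
  by rewrite !expgS comm_morphl ?groupX // IHn.
have nt_GZ : G / Z != 1.
  by rewrite -subG1 quotient_sub1 //; apply: contra nZg0 => /subsetP->.
pose p := pdiv #|G / Z|.
have p_pr : prime p by rewrite pdiv_prime // cardG_gt1.
have [xbar Gx ox] := Cauchy p_pr (pdiv_dvd _).
have [g nZg Gg def_x] := morphimP Gx.
have nZg' : g \notin Z.
  apply/negP => Zg; move: ox; rewrite def_x /= coset_id // order1 => p1.
  by rewrite -p1 in p_pr.
have Zgp : g ^+ p \in Z.
  by rewrite coset_idr ?groupX // morphX // -def_x -ox expg_order.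
have expZ z : z \in Z -> z ^+ p = 1.
  move=> Zz; have [y Gy <-] := Camina_comm_surj Gg nZg' Zz.
  by rewrite -commX // comm_centerl.
have expG h : h \in G -> h ^+ p \in Z.
  move=> Gh; apply/centerP; split=> [|y Gy]; first exact: groupX.
  apply/commgP/eqP; rewrite commX // expZ // (subsetP sG'Z) //.
  exact: mem_commg.
exists p; split=> //; apply/abelemP => //; split.
- exact: center_abelian.
- exact: expZ.
- exact: sub_der1_abelian.
move=> _ /morphimP[h nZh Gh ->]; rewrite -morphX //.
by apply: coset_id; apply: expG.
Qed.

Lemma Camina_bound_class2 : G^`(1) \subset Z -> #|Z| ^ 2 <= #|G : Z|.
Proof.
move=> sG'Z; have [p [p_pr abelZ abelQ]] := Camina_class2_abelem sG'Z.
have [nsZG ntZ /properP[sZG [g0 Gg0 nZg0]] _] := caminaG.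
have [_ nZG] := andP nsZG.
have ntQ : G / Z != 1.
  by rewrite -subG1 quotient_sub1 //; apply: contra nZg0 => /subsetP->.
pose rV := abelem_rV abelZ ntZ; pose Vr := rVabelem abelQ ntQ.
(* A mere section, not a morphism: its defect is central and invisible to commutators, so [c] is
   still bilinear. *)
pose s u := repr (Vr u).
have Gs u : s u \in G.
  suff: s u \in coset Z @*^-1 (G / Z) by rewrite quotientGK.
  by apply/morphpreP; rewrite repr_coset_norm /= coset_reprK mem_rVabelem.
have coset_s u : coset Z (s u) = Vr u by apply: coset_reprK.
have ZR x y : x \in G -> y \in G -> [~ x, y] \in Z.
  by move=> Gx Gy; rewrite (subsetP sG'Z) ?mem_commg.
pose c u v := rV [~ s u, s v].
have c0 u : c u u = 0%R by rewrite /c commgg [LHS]morph1.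
have cC u v : c v u = (- c u v)%R by rewrite /c -invg_comm [LHS]morphV ?ZR.
have ZQ g h : g \in G -> h \in G -> coset Z g = coset Z h ->
    exists2 z, z \in Z & g = h * z.
  move=> Gg Gh eq_gh; exists (h^-1 * g); last by rewrite mulKVg.
  have [nZg nZh] := (subsetP nZG g Gg, subsetP nZG h Gh).
  rewrite coset_idr ?groupM ?groupV // morphM ?groupV //= morphV //=.
  by rewrite eq_gh mulVg.
have cD u1 u2 v : c (u1 + u2)%R v = (c u1 v + c u2 v)%R.
  have [z Zz def_s] : exists2 z, z \in Z & s (u1 + u2)%R = s u1 * s u2 * z.
    apply: ZQ; rewrite ?groupM // morphM ?(subsetP nZG) //=.
    by rewrite !coset_s [LHS]rVabelemD.
  rewrite /c def_s comm_mul_centerl ?groupM // comm_morphl //.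
  by rewrite [LHS]morphM ?ZR.
have cZl a u v : (c (a *: u) v = a *: c u v)%R.
  (* Scalars of the prime field are natural multiples, so additivity suffices. *)
  rewrite -[a]natr_Zp !scaler_nat; elim: (val a) => [|k IHk].
    by rewrite !mulr0n; apply: (addrI (c 0%R v)); rewrite -cD !addr0.
  by rewrite !mulrS cD IHk.
have cE u v : (c u v = \sum_i u 0 i *: c (delta_mx 0 i) v)%R.
  have c0l : c 0%R v = 0%R by rewrite -(scale0r 0%R) cZl scale0r.
  rewrite {1}[u]row_sum_delta (big_morph (c^~ v) (fun x y => cD x y v) c0l).
  by apply: eq_bigr => i _; rewrite cZl.
have cEr u v : (c u v = \sum_j v 0 j *: c u (delta_mx 0 j))%R.
  rewrite cC cE -sumrN; apply: eq_bigr => j _.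
  by rewrite [in RHS]cC scalerN.
pose b i j k := (c (delta_mx 0 i) (delta_mx 0 j) 0 k)%R.
have b0 i k : b i i k = 0%R by rewrite /b c0 mxE.
have bC i j k : b j i k = (- b i j k)%R by rewrite /b cC mxE.
have nsg x : (x != 0 -> \det (form_mx b x) != 0)%R.
  (* Take [v] in the radical of the form given by the functional [X] on [Z]: then [X] kills every
     [c v w]. *)
  apply: contra => /det0P[v nz_v vB0].
  pose X := (\col_k x k)%R.
  have cvX w : (c v w *m X = 0)%R.
    rewrite cEr mulmx_suml big1 // => j _; rewrite -scalemxAl.
    suff -> : (c v (delta_mx 0 j) *m X = 0)%R by rewrite scaler0.
    apply/rowP=> i; rewrite ord1 mxE; move/rowP/(_ j): vB0; rewrite !mxE => vB0.
    rewrite -[RHS]vB0 cE.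
    under eq_bigr do rewrite summxE mulr_suml.
    rewrite exchange_big; apply: eq_bigr => l _ /=; rewrite !mxE mulr_sumr.
    by apply: eq_bigr => k _; rewrite !mxE mulrA.
  have nZsv : s v \notin Z.
    apply: contra nz_v => Zsv; apply/eqP/(rVabelem_inj abelQ ntQ).
    by rewrite rVabelem0 -/(Vr v) -coset_s coset_id.
  apply/eqP/ffunP=> k; rewrite ffunE.
  (* Each basis vector of [Z] is some [c v w], so all coordinates of [x] vanish. *)
  have [y Gy def_y] := Camina_comm_surj (Gs v) nZsv
    (mem_rVabelem abelZ ntZ (delta_mx 0 k)%R).
  pose w := abelem_rV abelQ ntQ (coset Z y).
  have [z Zz def_yw] : exists2 z, z \in Z & y = s w * z.
    by apply: ZQ; rewrite // coset_s [RHS]abelem_rV_K ?mem_quotient.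
  have : c v w = delta_mx 0%R k.
    by rewrite /c -(comm_mul_centerr Zz) // -def_yw def_y [LHS]rVabelemK.
  move/(congr1 (mulmx^~ X)); rewrite cvX -rowE => /rowP/(_ 0%R).
  by rewrite !mxE => <-.
have le_dim := alternating_space_dim p_pr (ltn0Sn _) b0 bC nsg.
rewrite -card_quotient // -(card_abelem_rV abelZ ntZ).
rewrite -(card_abelem_rV abelQ ntQ) !card_mx !mul1n card_Fp // -expnM.
by rewrite leq_exp2l ?prime_gt1 // mulnC.
Qed.

(** In class 2, |Z|^4 <= |G : Z|^2; otherwise compare cubes: |Z|^12 < |G : Z|^8 <= |G : Z|^9. *)
Lemma Camina_center_index_lt : #|Z| ^ 4 < #|G : Z| ^ 3.
Proof.
have idx_gt1 : 1 < #|G : Z|.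
  by have [_ _ /andP[_ sGZ] _] := caminaG; rewrite indexg_gt1.
have [/Camina_bound_class2 le2 | /Camina_bound_class_gt2 lt3] :=
    boolP (G^`(1) \subset Z).
  apply: leq_ltn_trans (_ : #|G : Z| ^ 2 < _); last by rewrite ltn_exp2l.
  by rewrite (expnM _ 2 2) leq_exp2r.
rewrite -(ltn_exp2r _ _ (isT : 0 < 3)) -!expnM (expnM _ 3 4).
apply: leq_trans (_ : (#|G : Z| ^ 2) ^ 4 <= _); first by rewrite ltn_exp2r.
by rewrite -expnM leq_exp2l.
Qed.

End CaminaCenter.

Local Open Scope ring_scope.

Theorem theorem3 (R : realType) (gT : finGroupType) (G : {group gT})
    (caminaG : Camina_pair G 'Z(G)%G) :
  #|'Z(G)%g|%:R < (#|G : 'Z(G)|%g%:R : R) `^ (3%:R / 4%:R).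
Proof.
(* Fourth powers turn the real exponent into a comparison of naturals. *)
rewrite -(ltr_pXn2r (isT : 0 < 4)%N) ?nnegrE ?powR_ge0 ?ler0n //.
rewrite -[X in _ < X]powR_mulrn ?powR_ge0 // -powRrM mulfVK ?pnatr_eq0 //.
by rewrite powR_mulrn // -!natrX ltr_nat Camina_center_index_lt.
Qed.
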